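(* Let $A$ be an infinite set of positive integers with $\gcd(A) = 1$, and let $\alpha,\beta$ be nonnegative real numbers. If $d_L(A) \geq \alpha$, then \[ \liminf_{n \rightarrow\infty}\frac{\log p_A(n)}{c_0\sqrt{n}} \geq \sqrt{\alpha}. \] If $d_U(A) \leq \beta$, then \[ \limsup_{n \rightarrow\infty}\frac{\log p_A(n)}{c_0\sqrt{n}} \leq \sqrt{\beta}. \]
   Context: For a set $A$ of positive integers, $A(x)$ denotes the number of elements of $A$ not exceeding $x$. The lower asymptotic density is $d_L(A) = \liminf_{x\to\infty} A(x)/x$ and the upper asymptotic density is $d_U(A) = \limsup_{x\to\infty} A(x)/x$. The greatest common divisor of all the elements of $A$ is denoted $\gcd(A)$. The partition function $p_A(n)$ counts the partitions of $n$ with parts in $A$, that is, representations of $n$ as a sum of not necessarily distinct elements of $A$ (any number of summands), where representations differing only in the order of the summands are identified; $p_A(0) = 1$. (Since $\gcd(A)=1$, $p_A(n)\ge 1$ for all sufficiently large $n$.) The constant is $c_0 = \pi\sqrt{2/3}$. *)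

(* Defs.v *)
From mathcomp Require Import all_boot all_order all_algebra.
From mathcomp Require Import finmap.
From mathcomp Require Import all_classical all_reals all_analysis.
Set Implicit Arguments.
Unset Strict Implicit.
Unset Printing Implicit Defensive.
Import Order.TTheory GRing.Theory Num.Theory.
Import numFieldNormedType.Exports.
Local Open Scope classical_set_scope.
Local Open Scope ring_scope.

Definition elements_upto (R : realType) (A : set nat) (x : R) : set nat :=
  [set a | A a /\ a%:R <= x].

(* [fset_set] is empty on infinite sets, but this set is always finite:
   see [finite_elements_upto]. *)
Definition counting (R : realType) (A : set nat) (x : R) : nat :=
  #|` fset_set (elements_upto A x)|.

Definition lower_density (R : realType) (A : set nat) : \bar R :=
  limf_einf (fun x : R => ((counting A x)%:R / x)%:E) (pinfty_nbhs R).

Definition upper_density (R : realType) (A : set nat) : \bar R :=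
  limf_esup (fun x : R => ((counting A x)%:R / x)%:E) (pinfty_nbhs R).

Definition common_divisor (A : set nat) (d : nat) : Prop :=
  forall a, A a -> (d %| a)%N.

Definition is_gcd (A : set nat) (g : nat) : Prop :=
  common_divisor A g /\ forall d, common_divisor A d -> (d <= g)%N.

(* A partition is encoded by the nonincreasing sequence of its parts; the
   empty sequence is the only partition of 0 into positive parts. *)
Definition partitions (A : set nat) (n : nat) : set (seq nat) :=
  [set s | [/\ sorted geq s, forall a, a \in s -> A a & sumn s = n]].

(* The set is finite as soon as the elements of A are positive: see
   [finite_partitions]. *)
Definition partition_function (A : set nat) (n : nat) : nat :=
  #|` fset_set (partitions A n)|.

Definition c0 (R : realType) : R := pi * Num.sqrt (2 / 3).

Definition log_partition_ratio (R : realType) (A : set nat) (n : nat) : R :=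
  ln (partition_function A n)%:R / (c0 R * Num.sqrt n%:R).

Lemma finite_elements_upto (R : realType) (A : set nat) (x : R) :
  finite_set (elements_upto A x).
Proof.
apply: (@sub_finite_set _ _ `I_(Num.truncn x).+1); last exact: finite_II.
move=> a [_ ax] /=; rewrite ltnS.
have x0 : 0 <= x by apply: le_trans ax; rewrite ler0n.
by rewrite truncn_ge_nat.
Qed.

Lemma finite_partitions (A : set nat) (n : nat) :
  A `<=` [set a | (0 < a)%N] -> finite_set (partitions A n).
Proof.
move=> A0.
pose f (u : {k : 'I_n.+1 & k.-tuple 'I_n.+1}) : seq nat :=
  [seq val i | i <- tagged u].
apply: (@sub_finite_set _ _ (range f)); last exact/finite_image/finite_finset.
move=> s [_ sA sn].
have bound (t : seq nat) : (forall a, a \in t -> (0 < a)%N) ->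
    (size t <= sumn t)%N /\ (forall a, a \in t -> (a <= sumn t)%N).
  elim: t => [|b t IH] //= t0.
  have [|h1 h2] := IH; first by move=> a at_; apply: t0; rewrite inE at_ orbT.
  have b0 : (0 < b)%N by apply: t0; rewrite mem_head.
  split; first by rewrite -add1n leq_add.
  move=> a; rewrite inE => /predU1P[->|/h2 /leq_trans->//]; first exact: leq_addr.
  exact: leq_addl.
have [sz le] := bound s (fun a h => A0 _ (sA a h)).
rewrite sn -ltnS in sz le.
pose t := in_tuple [seq inord a : 'I_n.+1 | a <- s].
have zt : size [seq inord a : 'I_n.+1 | a <- s] = Ordinal sz by rewrite size_map.
exists (Tagged (fun k : 'I_n.+1 => k.-tuple 'I_n.+1) (tcast zt t)) => //.
rewrite /f /= val_tcast /= -map_comp -[RHS]map_id; apply/eq_in_map => a /le al.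
by rewrite /= inordK.
Qed.

(* Main.v *)
Require Import Defs.
From mathcomp Require Import all_boot all_order all_algebra.
From mathcomp Require Import finmap.
From mathcomp Require Import all_classical all_reals all_analysis.
From mathcomp Require Import zify ring lra.
Import Order.TTheory GRing.Theory Num.Theory.
Import numFieldNormedType.Exports.
Local Open Scope classical_set_scope.
Local Open Scope ring_scope.

(** The asymptotics of the partition function p of the positive integers
    carry over to p_A by comparing parts: if the k-th element of A is about
    k / alpha, then replacing each part k of a partition by the k-th element
    of A multiplies the size of the partition by about 1 / alpha, so that
    p_A(n) behaves like p(alpha n), and log p(n) ~ c0 sqrt n.

    All comparisons go through P_A(n), the number of partitions of size at
    most n with parts in A, because the substitution of parts changes sizes
    in an uncontrolled way and only bounds them from above.  Three facts make
    this precise.  Discarding finitely many parts from A divides P_A(n) by at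
    most a power of n + 1 ([partition_sum_remove]), so an inequality between
    parts that fails for finitely many of them is harmless
    ([partition_sum_compare]).  A map that is injective on parts is injective
    on partitions ([partition_sum_map]).  Finally, since gcd(A) = 1, every
    large integer is a sum of elements of A ([representable_large]), so a
    partition of any size at most n can be completed to one of size exactly
    n + n0, and P_A(n) <= (n + 1) p_A(n + n0)
    ([partition_sum_le_function]).  For the upper bound the part a of A is
    replaced by the number of elements of A up to a, which is at most b a
    for b > beta and a large ([ln_partition_le]); for the lower bound the
    part k is replaced by the k-th element of A ([ln_partition_ge]).
    Polynomial factors disappear in the limit ([ln_negligible]).

    For ordinary partitions, both bounds on log p(n) follow by induction from
    the identity n p(n) = sum of v p(n - k v) over k, v >= 1
    ([npartitions_rec]), as in Erdos's elementary proof.  Substituting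
    exp(c sqrt m) for p(m) and using
    sqrt(n - k v) ~ sqrt n - k v / (2 sqrt n), the sum over v of
    v exp(- v x) ~ 1 / x^2, with x = c k / (2 sqrt n), turns the right-hand
    side into (4 n / c^2) exp(c sqrt n) times the sum of 1 / k^2.  It equals
    n exp(c sqrt n) exactly when c^2 = 4 zeta(2), that is when c = c0: this
    gives p(n) <= exp(c0 sqrt n) ([npartitions_le]) and, for c < c0, a lower
    bound C exp(c sqrt n) ([npartitions_ge]).

    The value zeta(2) = pi^2 / 6 ([harmonic2_le], [harmonic2_ge]) comes from
    iterating 4 / sin^2(2 x) = 1 / sin^2 x + 1 / cos^2 x from x = pi / 4,
    together with sin x <= x <= tan x. *)

(** * Partitions and their summatory function *)

Section Combinatorics.
Local Open Scope nat_scope.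

Lemma leq_card_fset_set_inj {T U : choiceType} (X : set T) (Y : set U)
    (f : T -> U) :
  finite_set Y -> {homo f : x / X x >-> Y x} ->
  {in X &, injective f} -> #|` fset_set X| <= #|` fset_set Y|.
Proof.
move=> finY XY injf.
case: (pselect (finite_set X)) => finX; last first.
  by rewrite /fset_set; case: pselect => // ?; rewrite cardfs0.
have <- : #|` [fset f x | x in fset_set X]%fset| = #|` fset_set X|.
  apply: card_in_imfset => x y.
  by rewrite !in_fset_set//; exact: injf.
apply: fsubset_leq_card; apply/fsubsetP => y /imfsetP[x /=].
by rewrite !in_fset_set// !inE => /XY ? ->.
Qed.

Lemma cardfsM {T U : choiceType} (A : {fset T}) (B : {fset U}) :
  #|` (A `*` B)%fset| = #|` A| * #|` B|.
Proof.
rewrite /fsetM (perm_size (enum_imfset2 _ _)) /=; last first.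
  by move=> [x y] [x' y'] _ _ /= [-> ->].
by rewrite size_allpairs.
Qed.

Lemma leq_card_fset_set_fibres {T U : choiceType} (X : set T) (Y : set U) n
    (g : T -> nat) (f : T -> U) :
  finite_set Y -> {homo f : x / X x >-> Y x} ->
  (forall x, X x -> g x < n) ->
  {in X &, forall x y, g x = g y -> f x = f y -> x = y} ->
  #|` fset_set X| <= n * #|` fset_set Y|.
Proof.
move=> finY XY gn inj.
have -> : n * #|` fset_set Y| = #|` fset_set (`I_n `*` Y)|.
  rewrite fset_setX// cardfsM; congr muln.
  by apply/esym/card_fset_set; exact: card_eqxx.
apply: (leq_card_fset_set_inj X (`I_n `*` Y) (fun x => (g x, f x))).
- exact: finite_setX.
- by move=> x Xx; split => /=; [exact: gn|exact: XY].
- by move=> x y Xx Yx [? ?]; exact: inj.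
Qed.

Lemma leq_card_fset_set_sub {T : choiceType} (X Y : set T) :
  finite_set Y -> X `<=` Y -> #|` fset_set X| <= #|` fset_set Y|.
Proof. by move=> finY XY; apply: (leq_card_fset_set_inj X Y id). Qed.

Definition partitions_le (A : set nat) (n : nat) : set (seq nat) :=
  [set s | [/\ sorted geq s, forall a, a \in s -> A a & sumn s <= n]].

(** The summatory function of p_A.  Unlike p_A it is monotone in n for every
    A, and it only asks for upper bounds on the sizes of partitions. *)
Definition partition_sum (A : set nat) (n : nat) : nat :=
  #|` fset_set (partitions_le A n)|.

Definition positive : set nat := [set a | 0 < a].

Local Notation npartitions := (partition_function positive).

Lemma finite_partitions_le (A : set nat) (n : nat) :
  A `<=` positive -> finite_set (partitions_le A n).
Proof.
move=> A0; apply: (@sub_finite_set _ _ (\bigcup_(m in `I_n.+1) partitions A m)).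
  by move=> s [? ? ?]; exists (sumn s).
by apply: bigcup_finite => [|m _]; [exact: finite_II|exact: finite_partitions].
Qed.

Lemma sorted_geq_perm (s t : seq nat) :
  sorted geq s -> sorted geq t -> perm_eq s t -> s = t.
Proof.
apply: sorted_eq => [x y z xy yz|x y /andP[]]; first exact: leq_trans yz xy.
by rewrite /geq /= => xy yx; apply/eqP; rewrite eqn_leq xy yx.
Qed.

Lemma sort_geq_sorted (s : seq nat) : sorted geq (sort geq s).
Proof. by apply: sort_sorted => x y; exact: leq_total. Qed.

Lemma sumn_sort (s : seq nat) : sumn (sort geq s) = sumn s.
Proof. by apply/perm_sumn; rewrite perm_sort. Qed.

Lemma partition_function_le_sum (A : set nat) (n : nat) :
  A `<=` positive -> partition_function A n <= partition_sum A n.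
Proof.
move=> A0; apply: leq_card_fset_set_sub; first exact: finite_partitions_le.
by move=> s [? ? <-]; split.
Qed.

Lemma sumn_filter_leq (P : pred nat) (s : seq nat) :
  sumn (seq.filter P s) <= sumn s.
Proof.
elim: s => //= a s IH; case: (P a) => /=; first by rewrite leq_add2l.
exact: leq_trans IH (leq_addl _ _).
Qed.

Lemma count_mem_leq_sumn (b : nat) (s : seq nat) :
  0 < b -> count_mem b s <= sumn s.
Proof.
move=> b0; elim: s => //= a s IH.
by apply: leq_add => //; case: eqP => // ->.
Qed.

(** A partition is determined by the multiplicity of b, which is at most n,
    and by its parts other than b. *)
Lemma partition_sum_remove1 (A : set nat) (b n : nat) :
  A `<=` positive -> 0 < b ->
  partition_sum A n <= n.+1 * partition_sum (A `\ b) n.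
Proof.
move=> A0 b0.
have finAb : finite_set (partitions_le (A `\ b) n).
  by apply: finite_partitions_le => a [/A0].
apply: (leq_card_fset_set_fibres _ _ _ (count_mem b) (seq.filter (predC1 b))) => //.
- move=> s [ss sA sn]; split.
  + by apply: sorted_filter => // x y z xy yz; exact: leq_trans yz xy.
  + move=> a; rewrite mem_filter /= => /andP[ab /sA Aa].
    by split => //= aE; rewrite aE eqxx in ab.
  + exact: leq_trans (sumn_filter_leq _ _) sn.
- by move=> s [ss sA sn]; rewrite ltnS (leq_trans _ sn)// count_mem_leq_sumn.
- move=> s t; rewrite !inE => -[ss _ _] [st _ _] cst fst.
  apply: sorted_geq_perm => //.
  rewrite -(perm_filterC (pred1 b) s).
  rewrite perm_sym -(perm_filterC (pred1 b) t) perm_sym.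
  have -> : seq.filter (predC (pred1 b)) s = seq.filter (predC (pred1 b)) t by [].
  have nE u : [seq x <- u | pred1 b x] = nseq (count_mem b u) b.
    by rewrite -size_filter; apply/all_pred1P/filter_all.
  by rewrite !nE cst.
Qed.

Lemma partition_sum_remove (A : set nat) (F : seq nat) (n : nat) :
  A `<=` positive -> {in F, forall b, 0 < b} ->
  partition_sum A n <= n.+1 ^ size F * partition_sum (A `\` [set` F]) n.
Proof.
elim: F A => [|b F IH] A A0 F0.
  rewrite expn0 mul1n; suff -> : A `\` [set` [::]] = A by [].
  by rewrite -[RHS]setD0; congr setD; apply/seteqP; split.
have -> : A `\` [set` b :: F] = (A `\ b) `\` [set` F].
  rewrite setDDl; congr setD; apply/seteqP; split=> a /=.
    by rewrite inE => /predU1P[->|]; [left|right].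
  by rewrite inE => -[->|->]; rewrite ?eqxx ?orbT.
apply: leq_trans (partition_sum_remove1 A b n A0 _) _.
  by apply: F0; rewrite mem_head.
rewrite /= expnS -mulnA leq_mul2l; apply/orP; right; apply: IH.
  by move=> a [/A0].
by move=> a aF; apply: F0; rewrite inE aF orbT.
Qed.

(** Substituting f b for each part b is injective on partitions because a
    left inverse of f recovers the multiset of parts. *)
Lemma partition_sum_map (A B : set nat) (f : nat -> nat) (m n : nat) :
  A `<=` positive -> {homo f : b / B b >-> A b} -> {in B &, injective f} ->
  (forall s, (forall b, b \in s -> B b) -> sumn s <= n ->
    sumn (map f s) <= m) ->
  partition_sum B n <= partition_sum A m.
Proof.
move=> A0 BA injf fmn; have finA := finite_partitions_le A m A0.
apply: (leq_card_fset_set_inj _ _ (fun s => sort geq (map f s))) => //.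
  move=> s [ss sB sn]; split; first exact: sort_geq_sorted.
    by move=> a; rewrite mem_sort => /mapP[b /sB /BA ? ->].
  by rewrite sumn_sort; exact: fmn.
move=> s t; rewrite !inE => -[ss sB _] [st tB _] fst.
have {fst} : perm_eq (map f s) (map f t).
  by rewrite -(perm_sort geq) fst perm_sort.
have [g fK] : exists g : nat -> nat, {in B, cancel f g}.
  case: (pselect (exists b, B b)) => [[b0 _]|nB]; last first.
    by exists id => b; rewrite inE => Bb; case: nB; exists b.
  exists (fun a => if pselect (exists2 b, B b & f b = a) is left h
                   then projT1 (cid2 h) else b0) => b Bb.
  case: pselect => [h|[]]; last by exists b => //; rewrite inE in Bb.
  by case: cid2 => /= b' Bb' fbb'; apply: injf => //; rewrite inE.
have mapK u : (forall b, b \in u -> B b) -> map g (map f u) = u.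
  move=> uB; rewrite -map_comp -[RHS]map_id; apply/eq_in_map => b /uB Bb /=.
  by rewrite fK// inE.
move=> /(perm_map g); rewrite !mapK//; exact: sorted_geq_perm.
Qed.

Definition representable (A : set nat) (n : nat) : Prop :=
  exists2 s, (forall a, a \in s -> A a) & sumn s = n.

Lemma representable0 (A : set nat) : representable A 0.
Proof. by exists [::]. Qed.

Lemma representable1 (A : set nat) (a : nat) : A a -> representable A a.
Proof.
by move=> Aa; exists [:: a] => [b|]; [rewrite inE => /eqP ->|rewrite /= addn0].
Qed.

Lemma representableD (A : set nat) (m n : nat) :
  representable A m -> representable A n -> representable A (m + n).
Proof.
move=> [s sA <-] [t tA <-]; exists (s ++ t); last exact: sumn_cat.
by move=> a; rewrite mem_cat => /orP[/sA|/tA].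
Qed.

Lemma representableM (A : set nat) (k n : nat) :
  representable A n -> representable A (k * n).
Proof.
by move=> An; elim: k => [|k IH];
  [exact: representable0|rewrite mulSn; exact: representableD].
Qed.

(** Let d be the least positive difference of two sums of elements of A, say
    of m and m + d.  If b in A left a remainder r > 0 modulo d, with quotient
    q, then b + q m and q (m + d) would be sums of elements of A differing by
    r < d.  So d divides every element of A, and d = 1: the consecutive sums
    m and m + 1 then generate every integer from m ^ 2 on. *)
Lemma representable_large (A : set nat) :
  A `<=` positive -> is_gcd A 1 ->
  exists n0, forall n, n0 <= n -> representable A n.
Proof.
move=> A0 [_ gcd1].
pose gap d := exists2 m, representable A m & representable A (m + d).
have [a Aa] : exists a, A a.
  apply: contrapT => nA; suff : 2 <= 1 by [].
  by apply: gcd1 => a Aa; case: nA; exists a.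
have exgap : exists d, (0 < d) && `[< gap d >].
  exists a; rewrite (A0 _ Aa) /=; apply/asboolP; exists 0.
    exact: representable0.
  by rewrite add0n; exact: representable1.
case: (ex_minnP exgap) => d /andP[d0 /asboolP[m Am Amd]] dmin.
have d1 : d = 1.
  apply/eqP; rewrite eqn_leq d0 andbT; apply: gcd1 => b Ab.
  rewrite /dvdn eqn0Ngt; apply/negP => r0.
  have := ltn_pmod b d0; rewrite ltnNge dmin// r0 /=; apply/asboolP.
  exists (b %/ d * (m + d)); first exact: representableM.
  have -> : b %/ d * (m + d) + b %% d = b + b %/ d * m.
    by rewrite mulnDr -addnA -divn_eq addnC.
  by apply: representableD; [exact: representable1|exact: representableM].
rewrite {}d1 in Amd.
exists (m * m) => n mn.
have [m0|m0] := posnP m.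
  by rewrite m0 add0n in Amd; rewrite -(muln1 n); exact: representableM.
have rq : n %% m <= n %/ m.
  by rewrite ltnW// (leq_trans (ltn_pmod n m0))// leq_divRL.
have -> : n = (n %/ m - n %% m) * m + n %% m * (m + 1).
  rewrite mulnDr muln1 addnA -mulnDl subnK//; exact: divn_eq.
by apply: representableD; exact: representableM.
Qed.

(** A partition s of size at most n is completed to size n + n0 by a fixed
    representation of the missing amount, which is at least n0; the size of s
    and the result determine s. *)
Lemma partition_sum_le_function (A : set nat) (n0 n : nat) :
  A `<=` positive -> (forall m, n0 <= m -> representable A m) ->
  partition_sum A n <= n.+1 * partition_function A (n + n0).
Proof.
move=> A0 rep.
have /choice[r rP] : forall m, exists s : seq nat,
    n0 <= m -> (forall a, a \in s -> A a) /\ sumn s = m.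
  by move=> m; have [/rep[s ? ?]|] := leqP n0 m; [exists s|exists [::]].
have le0 s : sumn s <= n -> n0 <= n + n0 - sumn s.
  by move=> sn; rewrite addnC -addnBA// leq_addr.
have finA := finite_partitions (n + n0) A0.
apply: (leq_card_fset_set_fibres _ _ _ sumn
  (fun s => sort geq (s ++ r (n + n0 - sumn s)))) => //.
- move=> s [ss sA sn]; have [rA rE] := rP _ (le0 _ sn).
  split; first exact: sort_geq_sorted.
  + by move=> a; rewrite mem_sort mem_cat => /orP[/sA|/rA].
  + by rewrite sumn_sort sumn_cat rE subnKC// (leq_trans sn) ?leq_addr.
- by move=> s [].
- move=> s t; rewrite !inE => -[ss _ _] [st _ _] <- E.
  apply: sorted_geq_perm => //.
  by rewrite -(perm_cat2r (r (n + n0 - sumn s))) -(perm_sort geq) E perm_sort.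
Qed.

Lemma sumn_count (s : seq nat) (n : nat) :
  (forall a, a \in s -> a <= n) ->
  sumn s = \sum_(v < n.+1) v * count_mem (v : nat) s.
Proof.
elim: s => [|a s IH] sn; first by rewrite big1// => v _; rewrite muln0.
rewrite /= IH => [|b bs]; last by apply: sn; rewrite inE bs orbT.
under [RHS]eq_bigr do rewrite mulnDr.
rewrite big_split /=; congr addn.
have an : a < n.+1 by rewrite ltnS sn ?mem_head.
rewrite (bigD1 (Ordinal an))//= eqxx muln1 big1 ?addn0// => v.
by rewrite -val_eqE /= eq_sym => /negPf ->; rewrite muln0.
Qed.

Lemma sum_ltn_ord (c n : nat) : c <= n -> \sum_(k < n) (k < c) = c.
Proof.
move=> cn; rewrite -[RHS](minn_idPl cn) {cn}.
elim: n => [|n IH]; first by rewrite big_ord0 minn0.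
rewrite big_ord_recr IH /=; case: ltnP => h.
  by rewrite (minn_idPr h) addn1.
by rewrite addn0 (minn_idPl (leqW h)).
Qed.

Lemma positive_refl : positive `<=` positive.
Proof. by []. Qed.

(** Separates k copies of v from the rest of s, so that cancelling them
    becomes an instance of [perm_cat2l]. *)
Lemma perm_nseq_count (s : seq nat) (v k : nat) : k <= count_mem v s ->
  perm_eq s
    (nseq k v ++ (nseq (count_mem v s - k) v ++ seq.filter (predC1 v) s)).
Proof.
move=> ks; rewrite catA -nseqD subnKC//.
rewrite -(perm_filterC (pred1 v) s) perm_cat2r.
by rewrite -size_filter; have /all_pred1P <- := filter_all (pred1 v) s.
Qed.

(** Removing k copies of v is a bijection onto the partitions of n - k v. *)
Lemma card_partitions_count (n v k : nat) : 0 < v ->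
  #|` fset_set [set s | partitions positive n s /\ k <= count_mem v s]| =
  if k * v <= n then npartitions (n - k * v) else 0.
Proof.
move=> v0.
have finP m := finite_partitions m positive_refl.
have finX : finite_set
    [set s | partitions positive n s /\ k <= count_mem v s].
  by apply: sub_finite_set (finP n) => s [].
pose g s := nseq (count_mem v s - k) v ++ seq.filter (predC1 v) s.
have gP s : k <= count_mem v s -> sumn s = k * v + sumn (g s).
  by move=> /perm_nseq_count/perm_sumn; rewrite sumn_cat sumn_nseq mulnC.
case: ifPn => [kvn|]; last first.
  rewrite -ltnNge => nkv; apply/eqP; rewrite cardfs_eq0; apply/eqP.
  rewrite -[RHS]fset_set0; congr fset_set; apply/seteqP; split=> // s [[_ _ sn]].
  by move=> /gP; rewrite sn => nE; move: nkv; rewrite nE ltnNge leq_addr.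
apply/eqP; rewrite eqn_leq; apply/andP; split.
  apply: (leq_card_fset_set_inj _ _ (fun s => sort geq (g s))) => //.
    move=> s [[ss s0 sn] ks]; split; first exact: sort_geq_sorted.
      move=> a; rewrite mem_sort mem_cat mem_nseq mem_filter.
      by move=> /orP[/andP[_ /eqP -> //]|/andP[_ /s0]].
    by rewrite sumn_sort -sn (gP s ks) addKn.
  move=> s t; rewrite !inE => -[[ss _ _] ks] [[st _ _] kt] E.
  apply: sorted_geq_perm => //.
  apply: perm_trans (perm_nseq_count _ _ _ ks) _.
  rewrite perm_sym; apply: perm_trans (perm_nseq_count _ _ _ kt) _.
  by rewrite perm_cat2l perm_sym -(perm_sort geq) E perm_sort.
apply: (leq_card_fset_set_inj _ _ (fun s => sort geq (nseq k v ++ s))) => //.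
  move=> s [ss s0 sn]; split; last first.
    have /permP -> : perm_eq (sort geq (nseq k v ++ s)) (nseq k v ++ s).
      by rewrite perm_sort.
    by rewrite count_cat count_nseq /= eqxx mul1n leq_addr.
  split; first exact: sort_geq_sorted.
    by move=> a; rewrite mem_sort mem_cat mem_nseq => /orP[/andP[_ /eqP ->]|/s0].
  by rewrite sumn_sort sumn_cat sumn_nseq sn mulnC subnKC.
move=> s t; rewrite !inE => -[ss _ _] [st _ _] E.
apply: sorted_geq_perm => //.
by rewrite -(perm_cat2l (nseq k v)) -(perm_sort geq) E perm_sort.
Qed.

(** Both sides add up the sizes of all partitions of n: the part v counts for
    v times its multiplicity, and that multiplicity is the number of k < n
    for which at least k + 1 copies of v occur. *)
Lemma npartitions_rec (n : nat) :
  n * npartitions n =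
  \sum_(v < n.+1) \sum_(k < n | k.+1 * v <= n) v * npartitions (n - k.+1 * v).
Proof.
have finP := finite_partitions n positive_refl.
have leqP s : partitions positive n s -> forall a, a \in s -> a <= n.
  move=> [_ _ <-] a; elim: s => //= b s IH; rewrite inE => /predU1P[->|/IH].
    exact: leq_addr.
  by move=> /leq_trans; apply; exact: leq_addl.
transitivity (\sum_(s <- fset_set (partitions positive n))
    \sum_(v < n.+1) \sum_(k < n) v * (k < count_mem (v : nat) s)).
  rewrite /partition_function card_fset_sum1 big_distrr /=.
  apply: eq_big_seq => s; rewrite in_fset_set// inE => sP.
  rewrite muln1; have [_ s0 sn] := sP; rewrite -{1}sn.
  rewrite (sumn_count _ _ (leqP _ sP)); apply: eq_bigr => v _.
  rewrite -big_distrr /=; have [->|v0] := posnP v; first by rewrite !mul0n.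
  by rewrite sum_ltn_ord// -[leqRHS]sn count_mem_leq_sumn.
rewrite exchange_big /=; apply: eq_bigr => v _.
rewrite exchange_big /= [RHS]big_mkcond /=; apply: eq_bigr => k _.
have [->|v0] := posnP v.
  by rewrite big1 ?mul0n ?if_same// => s _; rewrite mul0n.
rewrite -big_distrr /=; transitivity
    (v * if k.+1 * v <= n then npartitions (n - k.+1 * v) else 0); last first.
  by case: ifP => // _; rewrite muln0.
congr muln; rewrite -card_partitions_count// -big_mkcond card_fset_sum1 /=.
have -> : fset_set
    [set s | partitions positive n s /\ k < count_mem (v : nat) s] =
    [fset s in fset_set (partitions positive n) |
      k < count_mem (v : nat) s]%fset.
  apply/fsetP => s; rewrite !inE in_fset_set; last first.
    by apply: sub_finite_set finP => t [].
  by rewrite in_fset_set//; apply/idP/andP; rewrite !inE => -[].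
by rewrite big_fset_condE.
Qed.

End Combinatorics.

Local Notation npartitions := (partition_function positive).

(** * The sum of the inverse squares *)

Lemma sin_mvt (R : realType) (x : R) : 0 < x -> exists2 c, 0 < c < x &
  sin x = cos c * x.
Proof.
move=> x0; have [||c] := @MVT R sin cos 0 x.
- exact: x0.
- by apply: continuous_subspaceT; exact: continuous_sin.
rewrite in_itv /= sin0 !subr0 => cx E; by exists c.
Qed.

Lemma sinh_ge (R : realType) (y : R) : 0 <= y ->
  2 * y <= expR y - expR (- y).
Proof.
rewrite le_eqVlt => /predU1P[<-|y0]; first by rewrite mulr0 oppr0 subrr.
have [|||c _] := @MVT R (fun t => expR t - expR (- t))
  (fun t => expR t + expR (- t)) 0 y.
- exact: y0.
- move=> t _; apply: is_derive_eq.
  by rewrite /=; ring.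
- apply: continuous_subspaceT => t.
  apply: cvgB; first exact: continuous_expR.
  by apply: continuous_comp; [exact: opp_continuous|exact: continuous_expR].
rewrite /= oppr0 !expR0 addrN addr0 subr0 => ->.
rewrite ler_pM2r// expRN -subr_ge0.
have c0 := expR_gt0 c.
have -> : expR c + (expR c)^-1 - 2 = (expR c - 1) ^+ 2 / expR c.
  by field; rewrite gt_eqF.
by rewrite divr_ge0 ?sqr_ge0// ltW.
Qed.

Section Basel.
Context {R : realType}.
Implicit Types x y : R.

(** Equivalent to sin x <= x <= tan x, as cot^2 = 1 / sin^2 - 1.  Both sides
    come from sin x = x cos c with 0 < c < x and cos x <= cos c <= 1. *)
Lemma sin_bounds x : 0 < x < pi / 2 ->
  sin x ^- 2 - 1 <= x ^- 2 <= sin x ^- 2.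
Proof.
move=> /andP[x0 xpi]; have [c /andP[c0 cx] sE] := sin_mvt R x x0.
have sx0 : 0 < sin x by rewrite sin_gt0_pihalf ?x0.
have pi0 : pi / 2 <= pi :> R by have := pi_ge0 R; lra.
have cxc : cos x <= cos c.
  rewrite ltW// ltr_cos// in_itv /=; apply/andP; split; lra.
have cosx : 0 <= cos x by apply: cos_ge0_pihalf; apply/andP; split; lra.
have sx : sin x <= x by rewrite sE ler_piMl ?cos_le1// ltW.
apply/andP; split; last first.
  rewrite lef_pV2 ?posrE ?exprn_gt0//.
  by apply: lerXn2r => //; rewrite nnegrE ltW.
have -> : sin x ^- 2 - 1 = cos x ^+ 2 / sin x ^+ 2.
  by rewrite cos2sin2; field; rewrite gt_eqF.
rewrite ler_pdivrMr ?exprn_gt0// mulrC ler_pdivlMr ?exprn_gt0// -exprMn.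
apply: lerXn2r; rewrite ?nnegrE; first by rewrite mulr_ge0// ltW.
  exact: ltW.
by rewrite sE ler_wpM2r// ltW.
Qed.

(** The odd multiples of pi / 2^(n+2); those with k < 2^n lie in the first
    quadrant, where [sin_bounds] applies. *)
Definition odd_angle n k : R := k.*2.+1%:R * pi / 2 ^+ n.+2.

Lemma odd_angle_bounds n k : (k < 2 ^ n)%N -> 0 < odd_angle n k < pi / 2.
Proof.
move=> kn; apply/andP; split.
  rewrite /odd_angle; apply: divr_gt0; last by rewrite exprn_gt0.
  by apply: mulr_gt0; [rewrite ltr0n|exact: pi_gt0].
rewrite /odd_angle ltr_pdivrMr ?exprn_gt0// mulrC -mulrA ltr_pM2l ?pi_gt0//.
rewrite exprS mulKf // -natrX ltr_nat expnS mul2n.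
by rewrite ltn_Sdouble.
Qed.

(** Halving the angles of rank n gives the first half of those of rank n + 1,
    and x -> pi / 2 - x gives the second half.  Since
    4 / sin^2(2 x) = 1 / sin^2 x + 1 / cos^2 x, each step multiplies the sum by
    4; the only angle of rank 0 is pi / 4. *)
Lemma sum_sin_odd_angle n :
  \sum_(k < 2 ^ n) sin (odd_angle n k) ^- 2 = 2 * 4 ^+ n :> R.
Proof.
elim: n => [|n IH].
  rewrite expn0 big_ord1 /odd_angle /= mul1r expr0 mulr1.
  have -> : pi / 2 ^+ 2 = pi / 4 :> R by congr (_ / _); ring.
  have := cos2Dsin2 (pi / 4 : R).
  have c0 : cos (pi / 4) != 0 :> R.
    rewrite gt_eqF// cos_gt0_pihalf//; have := pi_gt0 R.
    by move=> ?; apply/andP; split; lra.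
  have -> : cos (pi / 4) = sin (pi / 4) :> R.
    by have := tan_piquarter R; rewrite /tan => /(canRL (mulfVK c0)); rewrite mul1r.
  move=> h; have -> : sin (pi / 4) ^+ 2 = 2^-1 :> R by lra.
  by rewrite invrK.
have -> : (2 ^ n.+1 = 2 ^ n + 2 ^ n)%N by rewrite expnS mul2n addnn.
rewrite big_split_ord /= [X in _ + X](reindex_inj rev_ord_inj) /= -big_split /=.
rewrite exprS mulrCA -IH mulr_sumr; apply: eq_bigr => k _.
have kn := ltn_ord k.
have E1 : odd_angle n k = odd_angle n.+1 k *+ 2.
  rewrite /odd_angle (exprS _ n.+2) -mulr_natr; field.
  by rewrite expf_neq0.
have E2 : odd_angle n.+1 (2 ^ n + (2 ^ n - k.+1)) = pi / 2 - odd_angle n.+1 k.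
  rewrite /odd_angle; have -> : ((2 ^ n + (2 ^ n - k.+1)).*2.+1 =
    2 ^ n.+2 - k.*2.+1)%N.
    rewrite !expnS; clear -kn; lia.
  rewrite natrB; last first.
    by rewrite !expnS; clear -kn; lia.
  rewrite natrX (exprS _ n.+2); field.
  by rewrite expf_neq0.
have /odd_angle_bounds/andP[a0 api] : (k < 2 ^ n.+1)%N.
  by rewrite (leq_trans kn)// leq_exp2l.
have s0 : sin (odd_angle n.+1 k) != 0.
  by rewrite gt_eqF// sin_gt0_pihalf// a0.
have c0 : cos (odd_angle n.+1 k) != 0.
  rewrite gt_eqF// cos_gt0_pihalf//; apply/andP; split=> //; lra.
have -> : sin (odd_angle n.+1 (2 ^ n + (2 ^ n - k.+1))) =
    cos (odd_angle n.+1 k).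
  by rewrite E2 -cosBpihalf -cosN; congr cos; ring.
rewrite E1 sin_mulr2n.
have := cos2Dsin2 (odd_angle n.+1 k).
move: s0 c0; move: (sin _) (cos _) => s c s0 c0 h.
transitivity ((c ^+ 2 + s ^+ 2) / (c * s) ^+ 2); first by field; rewrite s0 c0.
by rewrite h; field; rewrite s0 c0.
Qed.

(** [sin_bounds] is summed over the 2^n angles of rank n.  The error of 1 per
    angle is negligible against the sum 2 * 4^n. *)
Lemma sum_odd_inv_sqr n :
  pi ^+ 2 / 8 * (1 - 2 ^- n) <= \sum_(k < 2 ^ n) (k.*2.+1%:R : R) ^- 2
    <= pi ^+ 2 / 8.
Proof.
have pi0 : pi != 0 :> R by rewrite gt_eqF ?pi_gt0.
have pi2 : 0 < pi ^+ 2 :> R by rewrite exprn_gt0// pi_gt0.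
have E : \sum_(k < 2 ^ n) k.*2.+1%:R ^- 2 =
    pi ^+ 2 / 16 / 4 ^+ n * \sum_(k < 2 ^ n) (odd_angle n k) ^- 2.
  rewrite mulr_sumr; apply: eq_bigr => k _; rewrite /odd_angle.
  have -> : 4 ^+ n = 2 ^+ n * 2 ^+ n :> R by rewrite -exprMn; congr (_ ^+ _); ring.
  rewrite !exprS; move: pi0; move: (pi : R) => p p0; field.
  by rewrite expf_neq0// p0 nat1r pnatr_eq0.
have P : 0 < pi ^+ 2 / 16 / 4 ^+ n :> R by rewrite !divr_gt0 ?exprn_gt0 ?pi_gt0.
have bnd k := sin_bounds _ (odd_angle_bounds n _ (ltn_ord k)).
have S := sum_sin_odd_angle n.
rewrite E; apply/andP; split; last first.
  apply: (@le_trans _ _ (pi ^+ 2 / 16 / 4 ^+ n * (2 * 4 ^+ n))).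
    by rewrite ler_pM2l// -S; apply: ler_sum => k _; case/andP: (bnd k).
  by rewrite le_eqVlt; apply/orP; left; apply/eqP; field; rewrite expf_neq0.
apply: (@le_trans _ _ (pi ^+ 2 / 16 / 4 ^+ n * (2 * 4 ^+ n - 2 ^+ n))).
  have -> : 4 ^+ n = 2 ^+ n * 2 ^+ n :> R.
    by rewrite -exprMn; congr (_ ^+ _); ring.
  have t0 : 0 < 2 ^- n :> R by rewrite invr_gt0 exprn_gt0.
  have -> : pi ^+ 2 / 16 / (2 ^+ n * 2 ^+ n) * (2 * (2 ^+ n * 2 ^+ n) - 2 ^+ n) =
     pi ^+ 2 / 8 * (1 - 2^-1 * 2 ^- n) :> R.
    by field; rewrite expf_neq0.
  by rewrite ler_pM2l ?divr_gt0//; lra.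
rewrite ler_pM2l// -S.
have -> : 2 ^+ n = \sum_(k < 2 ^ n) 1 :> R.
  by rewrite sumr_const card_ord -natrX.
by rewrite -sumrB; apply: ler_sum => k _; case/andP: (bnd k).
Qed.

(** The partial sums of zeta(2). *)
Definition harmonic2 n : R := \sum_(k < n) k.+1%:R ^- 2.

Lemma harmonic2_double n : harmonic2 (n + n) =
  \sum_(k < n) k.*2.+1%:R ^- 2 + harmonic2 n / 4.
Proof.
have hS m : harmonic2 m.+1 = harmonic2 m + m.+1%:R ^- 2.
  by rewrite /harmonic2 big_ord_recr.
elim: n => [|n IH]; first by rewrite /harmonic2 !big_ord0 mul0r addr0.
rewrite addSn addnS !hS IH big_ord_recr /= addnn.
have -> : n.*2.+2%:R = 2 * n.+1%:R :> R by rewrite -natrM mul2n doubleS.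
have -> : (2 * n.+1%:R) ^- 2 = n.+1%:R ^- 2 / 4 :> R.
  by rewrite exprMn invfM mulrC; congr (_ * _^-1); ring.
by rewrite mulrDl; ring.
Qed.

Lemma harmonic2_nd : {homo harmonic2 : m n / (m <= n)%N >-> m <= n}.
Proof.
apply: homo_leq => // [y x z|n]; first exact: le_trans.
by rewrite /harmonic2 big_ord_recr /= lerDl invr_ge0 exprn_ge0.
Qed.

(** With N = 2^n, splitting the terms by parity gives
    H(N) <= H(2 N) <= pi^2 / 8 + H(N) / 4, which can be solved for H(N). *)
Lemma harmonic2_le n : harmonic2 n <= pi ^+ 2 / 6.
Proof.
apply: (@le_trans _ _ (harmonic2 (2 ^ n))).
  by apply: harmonic2_nd; rewrite ltnW// ltn_expl.
have /andP[_ h] := sum_odd_inv_sqr n.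
have := harmonic2_nd _ _ (leq_addl (2 ^ n) (2 ^ n)).
by rewrite harmonic2_double; lra.
Qed.

(** The recursion H(2 N) = O(N) + H(N) / 4 divides the distance to pi^2 / 6 by
    4 while adding an error of order 1 / N, with N = 2^n; hence a distance of
    order 1 / N. *)
Lemma harmonic2_ge n : pi ^+ 2 / 6 - pi ^+ 2 / 2 * 2 ^- n <= harmonic2 (2 ^ n).
Proof.
have p2 : 0 <= pi ^+ 2 :> R by exact: sqr_ge0.
elim: n => [|n IH].
  rewrite expr0 invr1 mulr1; apply: (@le_trans _ _ 0); first by lra.
  by apply: sumr_ge0 => k _; rewrite invr_ge0 exprn_ge0.
rewrite expnS mul2n -addnn harmonic2_double.
have /andP[h _] := sum_odd_inv_sqr n.
rewrite (exprS (2 : R)) invfM.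
have t0 : 0 <= pi ^+ 2 * 2 ^- n :> R by rewrite divr_ge0// exprn_ge0.
by lra.
Qed.

Lemma harmonic2_gt x : x < pi ^+ 2 / 6 -> exists n, x < harmonic2 n.
Proof.
move=> xlt; have x0 : 0 < pi ^+ 2 / 6 - x by rewrite subr_gt0.
pose n := (Num.truncn (pi ^+ 2 / 2 / (pi ^+ 2 / 6 - x))).+1.
exists (2 ^ n)%N; apply: lt_le_trans (harmonic2_ge n).
have : pi ^+ 2 / 2 / (pi ^+ 2 / 6 - x) < 2 ^+ n.
  apply: (lt_trans (truncnS_gt _)).
  by rewrite -natrX ltr_nat ltn_expl.
rewrite ltr_pdivrMr// => h.
suff : pi ^+ 2 / 2 / 2 ^+ n < pi ^+ 2 / 6 - x by lra.
by rewrite ltr_pdivrMr ?exprn_gt0// [ltRHS]mulrC.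
Qed.
End Basel.

(** * Sums of v exp(- v x) *)

Section ArithmeticoGeometric.
Context {R : realType}.
Implicit Types (q x y : R) (m : nat).

Lemma sum_arithmetico_geometric q m :
  (1 - q) ^+ 2 * \sum_(v < m.+1) v%:R * q ^+ v =
  q * (1 - q ^+ m * (1 + m%:R * (1 - q))).
Proof.
elim: m => [|m IH]; first by rewrite big_ord1 /=; ring.
by rewrite big_ord_recr /= mulrDr IH (exprS q) -natr1; ring.
Qed.

(** With q = exp(- x), the infinite sum is q / (1 - q)^2, which is the inverse
    square of 2 sinh(x / 2) >= x. *)
Lemma sum_exp_le x m : 0 < x ->
  \sum_(v < m) v%:R * expR (- (v%:R * x)) <= x ^- 2.
Proof.
move=> x0; have q0 := expR_gt0 (- x); set q := expR (- x) in q0.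
have q1 : q < 1 by rewrite expR_lt1 oppr_lt0.
have -> : \sum_(v < m) v%:R * expR (- (v%:R * x)) =
    \sum_(v < m) v%:R * q ^+ v.
  by apply: eq_bigr => v _; rewrite -mulrN expRM_natl.
apply: (@le_trans _ _ (\sum_(v < m.+1) v%:R * q ^+ v)).
  by rewrite big_ord_recr /= lerDl mulr_ge0 ?exprn_ge0// ltW.
apply: (@le_trans _ _ (q / (1 - q) ^+ 2)).
  rewrite ler_pdivlMr ?exprn_gt0 ?subr_gt0// mulrC.
  rewrite sum_arithmetico_geometric ger_pMr// lerBlDl lerDr.
  by rewrite mulr_ge0 ?exprn_ge0 ?addr_ge0 ?mulr_ge0 ?subr_ge0// ltW.
rewrite ler_pdivrMr ?exprn_gt0 ?subr_gt0// mulrC ler_pdivlMr ?exprn_gt0//.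
pose s := expR (x / 2); have s0 : 0 < s := expR_gt0 _.
have qs : q = s^-1 ^+ 2 by rewrite /s -expRN -expRM_natl; congr expR; field.
have h : x <= s - s^-1.
  have /sinh_ge : 0 <= x / 2 by lra.
  by rewrite expRN -/s; lra.
have -> : (1 - q) ^+ 2 = q * (s - s^-1) ^+ 2.
  by rewrite qs; field; rewrite gt_eqF.
by rewrite ler_pM2l//; apply: lerXn2r; rewrite ?nnegrE//; lra.
Qed.

(** The truncated sum misses at most a fraction (1 + z) exp(- z) <= 4 / z of the
    full one, where z = m x. *)
Lemma sum_exp_ge x y m : 0 < x -> x <= 1 -> 0 < y -> y <= m%:R * x ->
  (1 - x) * (1 - 4 / y) / x ^+ 2 <= \sum_(v < m.+1) v%:R * expR (- (v%:R * x)).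
Proof.
move=> x0 x1 y0 ymx; have q0 := expR_gt0 (- x); set q := expR (- x) in q0.
have q1 : q < 1 by rewrite expR_lt1 oppr_lt0.
have qx : 1 - x <= q by exact: expR_ge1Dx.
have -> : \sum_(v < m.+1) v%:R * expR (- (v%:R * x)) =
    \sum_(v < m.+1) v%:R * q ^+ v.
  by apply: eq_bigr => v _; rewrite -mulrN expRM_natl.
set S := \sum_(v < _) _.
have S0 : 0 <= S by apply: sumr_ge0 => v _; rewrite mulr_ge0 ?exprn_ge0// ltW.
rewrite ler_pdivrMr ?exprn_gt0//.
apply: (@le_trans _ _ ((1 - q) ^+ 2 * S)); last first.
  rewrite mulrC ler_wpM2l//; apply: lerXn2r; rewrite ?nnegrE ?subr_ge0; lra.
rewrite sum_arithmetico_geometric.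
have z0 : 0 < m%:R * x by exact: lt_le_trans ymx.
have tail : q ^+ m * (1 + m%:R * (1 - q)) <= 4 / y.
  apply: (@le_trans _ _ (expR (- (m%:R * x)) * (1 + m%:R * x))).
    rewrite -mulrN expRM_natl ler_pM2l ?exprn_gt0// lerD2l ler_wpM2l//; lra.
  set z := m%:R * x in z0 ymx *; rewrite expRN.
  have e1 : (1 + z / 2) ^+ 2 <= expR z.
    have -> : expR z = expR (z / 2) ^+ 2.
      by rewrite -expRM_natl; congr expR; field.
    apply: lerXn2r; rewrite ?nnegrE ?expR_ge0 ?expR_ge1Dx//; lra.
  have ez := expR_gt0 z.
  rewrite mulrC ler_pdivrMr// mulrAC ler_pdivlMr//.
  apply: (@le_trans _ _ (4 * (1 + z / 2) ^+ 2)); last by rewrite ler_pM2l.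
  apply: (@le_trans _ _ ((1 + z) * z)); first by rewrite ler_pM2l//; lra.
  have -> : 4 * (1 + z / 2) ^+ 2 = (1 + z) * z + (4 + 3 * z) by field.
  by lra.
have [hy|hy] := lerP (1 - 4 / y) 0.
  rewrite -sum_arithmetico_geometric.
  apply: (@le_trans _ _ 0); last by rewrite mulr_ge0 ?sqr_ge0.
  by rewrite mulr_ge0_le0// subr_ge0.
by rewrite ler_pM//; lra.
Qed.
End ArithmeticoGeometric.

(** * Exponential bounds for the partitions of an integer *)

Lemma npartitions0 : npartitions 0 = 1%N.
Proof.
rewrite /partition_function (_ : partitions positive 0 = [set [::]]).
  by rewrite fset_set1 cardfs1.
apply/seteqP; split=> [s [_ s0 sn]|s ->] //=.
case: s s0 sn => //= a s s0 /eqP; rewrite addn_eq0 => /andP[/eqP a0 _].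
by have := s0 a (mem_head _ _); rewrite /positive /= a0.
Qed.

Lemma npartitions_gt0 n : (0 < npartitions n)%N.
Proof.
have finP := finite_partitions n positive_refl.
rewrite /partition_function cardfs_gt0; apply/fset0Pn.
exists (nseq n 1%N); rewrite in_fset_set// inE; split.
- by elim: n {finP} => //= -[].
- by move=> a; rewrite mem_nseq => /andP[_ /eqP ->].
- by rewrite sumn_nseq mul1n.
Qed.

Section PartitionBounds.
Context {R : realType}.
Local Notation sqrtn n := (Num.sqrt (n%:R : R)).

Lemma c0_gt0 : 0 < c0 R.
Proof. by rewrite mulr_gt0 ?pi_gt0// sqrtr_gt0; lra. Qed.

Lemma sqr_c0 : c0 R ^+ 2 = 4 * (pi ^+ 2 / 6).
Proof. by rewrite exprMn sqr_sqrtr; [field|lra]. Qed.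

Lemma sqrt_sub_le (x y : R) : 0 < x -> y <= x ->
  Num.sqrt (x - y) <= Num.sqrt x - y / (2 * Num.sqrt x).
Proof.
move=> x0 yx; have r0 : 0 < Num.sqrt x by rewrite sqrtr_gt0.
have xE : x = Num.sqrt x ^+ 2 by rewrite sqr_sqrtr// ltW.
set r := Num.sqrt x in r0 xE *.
have h : r - y / (2 * r) = (r ^+ 2 + (r ^+ 2 - y)) / (2 * r).
  by field; rewrite gt_eqF.
have h0 : 0 <= r - y / (2 * r).
  by rewrite h -xE; apply: divr_ge0; lra.
rewrite -[leRHS]ger0_norm// -sqrtr_sqr ler_wsqrtr//.
have -> : (r - y / (2 * r)) ^+ 2 = r ^+ 2 - y + (y / (2 * r)) ^+ 2.
  by field; rewrite gt_eqF.
by rewrite -xE lerDl sqr_ge0.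
Qed.

(** Converse of [sqrt_sub_le] up to a factor 1 + d on the linear term, valid
    as long as y is small compared with x. *)
Lemma sqrt_sub_ge (x y d : R) : 0 < x -> 0 <= y -> y <= d * x -> d <= 1 ->
  Num.sqrt x - (1 + d) * y / (2 * Num.sqrt x) <= Num.sqrt (x - y).
Proof.
move=> x0 y0 yx d1; have r0 : 0 < Num.sqrt x by rewrite sqrtr_gt0.
have xE : x = Num.sqrt x ^+ 2 by rewrite sqr_sqrtr// ltW.
set r := Num.sqrt x in r0 xE *.
have d0 : 0 <= d by rewrite -(pmulr_lge0 _ x0); exact: le_trans yx.
apply: le_trans (ler_norm _) _; rewrite -sqrtr_sqr ler_wsqrtr//.
have -> : (r - (1 + d) * y / (2 * r)) ^+ 2 =
   r ^+ 2 - y - y * (d - ((1 + d) / 2) ^+ 2 * (y / r ^+ 2)).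
  by field; rewrite gt_eqF.
rewrite -xE gerBl mulr_ge0// subr_ge0.
apply: (@le_trans _ _ (1 * d)); last by rewrite mul1r.
have h1 : ((1 + d) / 2) ^+ 2 <= 1 by rewrite expr_le1//; lra.
have h2 : y / x <= d by rewrite ler_pdivrMr.
by rewrite ler_pM ?sqr_ge0 ?divr_ge0// ltW.
Qed.

(** Strong induction on n through [npartitions_rec].  The constant c0 is
    exactly the one for which the bound reproduces itself:
    (4 n / c0^2) (pi^2 / 6) = n. *)
Lemma npartitions_le n : (npartitions n)%:R <= expR (c0 R * sqrtn n).
Proof.
elim/ltn_ind: n => n IH.
have [->|n0] := posnP n; first by rewrite npartitions0 sqrtr0 mulr0 expR0.
have n0R : 0 < n%:R :> R by rewrite ltr0n.
have r0 : 0 < sqrtn n by rewrite sqrtr_gt0.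
have nE : n%:R = sqrtn n ^+ 2 by rewrite sqr_sqrtr// ltW.
have c00 := c0_gt0.
rewrite -(ler_pM2l n0R) -natrM npartitions_rec.
pose x k : R := c0 R * k.+1%:R / (2 * sqrtn n).
have x0 k : 0 < x k.
  by rewrite /x; apply: divr_gt0; apply: mulr_gt0 => //; exact: ltr0Sn.
apply: (@le_trans _ _ (\sum_(v < n.+1) \sum_(k < n)
    expR (c0 R * sqrtn n) * (v%:R * expR (- (v%:R * x k))))).
  rewrite natr_sum; apply: ler_sum => v _; rewrite natr_sum big_mkcond /=.
  apply: ler_sum => k _; case: ifPn => [kvn|_]; last first.
    by rewrite !mulr_ge0 ?expR_ge0.
  have [->|v0] := posnP v; first by rewrite !mul0r mulr0.
  rewrite natrM mulrCA ler_pM2l ?ltr0n// -expRD.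
  apply: le_trans (IH _ _) _.
    by rewrite ltn_subrL n0 muln_gt0 v0.
  rewrite ler_expR natrB// natrM.
  have := @sqrt_sub_le n%:R (k.+1%:R * v%:R) n0R.
  rewrite -natrM ler_nat natrM => /(_ kvn).
  rewrite -(ler_pM2l c00) => /le_trans; apply.
  by rewrite le_eqVlt; apply/orP; left; apply/eqP; rewrite /x; field; rewrite gt_eqF.
rewrite exchange_big /=.
under eq_bigr do rewrite -mulr_sumr.
rewrite -mulr_sumr [leRHS]mulrC ler_pM2l ?expR_gt0//.
apply: (@le_trans _ _ (\sum_(k < n) x k ^- 2)).
  by apply: ler_sum => k _; exact: sum_exp_le.
have -> : \sum_(k < n) x k ^- 2 = 4 * n%:R / c0 R ^+ 2 * harmonic2 n.
  rewrite mulr_sumr; apply: eq_bigr => k _; rewrite /x [in RHS]nE.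
  have k0 : k.+1%:R != 0 :> R by rewrite pnatr_eq0.
  move: k0 r0 c00; move: (k.+1%:R) (sqrtn n) (c0 R) => a b c a0 b0 c0.
  by field; rewrite a0 !gt_eqF.
apply: (@le_trans _ _ (4 * n%:R / c0 R ^+ 2 * (pi ^+ 2 / 6))).
  apply: ler_wpM2l; last exact: harmonic2_le.
  by apply: divr_ge0; [exact: mulr_ge0|exact: sqr_ge0].
rewrite sqr_c0; have : 0 < pi ^+ 2 / 6 :> R by rewrite divr_gt0 ?exprn_gt0 ?pi_gt0.
move: (pi ^+ 2 / 6) => z z0.
by rewrite le_eqVlt; apply/orP; left; apply/eqP; field; rewrite gt_eqF.
Qed.

(** The function exp(c sqrt m) satisfies the recursion of p with <= in place
    of =, from some rank on.  Only the terms with k <= K and v <= L sqrt n are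
    kept: K brings the sum of 1 / k^2 above c^2 / 4, which is possible because
    c < c0, and L makes the truncation of the sums over v harmless.  On these
    terms k v is O(sqrt n), so the linear approximation of sqrt(n - k v) is
    accurate. *)
Lemma npartitions_step (c : R) : 0 < c -> c < c0 R ->
  exists n1 : nat, forall n, (n1 <= n)%N ->
    n%:R * expR (c * sqrtn n) <= \sum_(v < n.+1) \sum_(k < n | (k.+1 * v <= n)%N)
       v%:R * expR (c * sqrtn (n - k.+1 * v)).
Proof.
move=> c_gt0 cc0.
have [K HK] : exists K, c ^+ 2 / 4 < @harmonic2 R K.
  apply: harmonic2_gt.
  have : c ^+ 2 < c0 R ^+ 2 by rewrite ltr_pXn2r// nnegrE ltW// c0_gt0.
  by rewrite sqr_c0; lra.
have c2 : 0 < c ^+ 2 by rewrite exprn_gt0.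
set h := @harmonic2 R K in HK *.
have h0 : 0 < h by apply: lt_trans HK; rewrite divr_gt0.
(* The relative error d allowed at each approximation: the losses amount to
   ((1 - d) / (1 + d)) ^ 2 >= 1 - 4 d, and 1 - 4 d = c ^ 2 / (4 h). *)
pose d := (h - c ^+ 2 / 4) / (4 * h).
have d0 : 0 < d by rewrite divr_gt0 ?mulr_gt0// subr_gt0.
have dE : c ^+ 2 = 4 * h * (1 - 4 * d).
  by rewrite /d; field; rewrite gt_eqF.
have d4 : d < 4^-1.
  have : 0 < 1 - 4 * d by rewrite -(pmulr_rgt0 _ (_ : 0 < 4 * h)) -?dE// mulr_gt0.
  by lra.
clearbody d.
(* Chosen so that m x_k >= 4 / d below, as [sum_exp_ge] requires. *)
pose L := 16 / (c * d).
have L0 : 0 < L by apply: divr_gt0 => //; exact: mulr_gt0.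
have LE : L * (c * d) = 16 by rewrite divfK// gt_eqF// mulr_gt0.
clearbody L.
have K0 : 0 <= K%:R :> R by [].
(* Each summand of r1 is a lower bound that sqrt n has to satisfy. *)
pose r1 := K%:R * L / d + c * K%:R / d + 2 / L + K%:R + L + 1.
have Kd : 0 <= K%:R * L / d by rewrite divr_ge0 ?mulr_ge0// ltW.
have cd : 0 <= c * K%:R / d by rewrite divr_ge0 ?mulr_ge0// ltW.
have L2 : 0 <= 2 / L by rewrite divr_ge0// ltW.
exists (Num.truncn (r1 ^+ 2)).+1 => n n1n.
set r := sqrtn n.
have r1r : r1 <= r.
  have r10 : 0 <= r1 by rewrite /r1; lra.
  rewrite -[leLHS]ger0_norm// -sqrtr_sqr ler_wsqrtr// ltW//.
  by apply: lt_le_trans (truncnS_gt _) _; rewrite ler_nat.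
have r0 : 0 < r by move: r1r; rewrite /r1; lra.
have nE : n%:R = r ^+ 2 by rewrite /r sqr_sqrtr.
have n0 : 0 < n%:R :> R by rewrite nE exprn_gt0.
have rn : r <= n%:R.
  by rewrite nE expr2 ler_peMl// ?ltW//; move: r1r; rewrite /r1; lra.
pose m := Num.truncn (L * r).
have Lr0 : 0 <= L * r by rewrite mulr_ge0 ?ltW.
have mLr : m%:R <= L * r by rewrite truncn_le.
have Lrm : L * r - 1 <= m%:R.
  by rewrite lerBlDr natr1 ltW// truncnS_gt.
have Kn : (K <= n)%N.
  by rewrite -(ler_nat R); apply: le_trans rn; move: r1r; rewrite /r1; lra.
have KLr : K%:R * L <= d * r.
  by rewrite [leRHS]mulrC -ler_pdivrMr//; move: r1r; rewrite /r1; lra.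
have cKr : c * K%:R <= d * r.
  by rewrite [leRHS]mulrC -ler_pdivrMr//; move: r1r; rewrite /r1; lra.
have Lr2 : 2 <= L * r.
  by rewrite [leRHS]mulrC -ler_pdivrMr//; move: r1r; rewrite /r1; lra.
have kvdn k v : (k < K)%N -> (v <= m)%N -> (k.+1 * v)%:R <= d * n%:R.
  move=> kK vm; rewrite natrM.
  apply: (@le_trans _ _ (K%:R * (L * r))).
    by rewrite ler_pM// ?ler_nat//; apply: le_trans mLr; rewrite ler_nat.
  by rewrite mulrA nE expr2 mulrA ler_pM2r.
have mn : (m <= n)%N.
  have [K00|K00] := posnP K.
    by move: h0; rewrite /h K00 /harmonic2 big_ord0 ltxx.
  rewrite -(ler_nat R); have := kvdn 0%N m K00 (leqnn _); rewrite mul1n.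
  by move=> /le_trans; apply; rewrite ler_piMl// ; lra.
pose x k : R := c * (1 + d) * k.+1%:R / (2 * r).
have x0 k : 0 < x k.
  by rewrite /x; apply: divr_gt0; rewrite ?mulr_gt0 ?addr_gt0 ?ltr0Sn.
apply: (@le_trans _ _ (\sum_(k < K) \sum_(v < m.+1)
    expR (c * r) * (v%:R * expR (- (v%:R * x k))))); last first.
  pose G k v : R := expR (c * r) * (v%:R * expR (- (v%:R * x k))).
  have G0 k v : 0 <= G k v by rewrite /G !mulr_ge0 ?expR_ge0.
  rewrite exchange_big /= (big_ord_widen n.+1 (fun v => \sum_(k < K) G k v))//.
  rewrite big_mkcond; apply: ler_sum => v _; case: ifPn => [vm|_]; last first.
    by apply: sumr_ge0 => k _; rewrite mulr_ge0 ?expR_ge0.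
  rewrite (big_ord_widen n (fun k => G k v))// big_mkcond [leRHS]big_mkcond.
  apply: ler_sum => k _; case: ifPn => [kK|_]; last first.
    by case: ifPn => // _; rewrite mulr_ge0 ?expR_ge0.
  have kvd := kvdn k v kK vm.
  have kvn : (k.+1 * v <= n)%N.
    by rewrite -(ler_nat R); apply: le_trans kvd _; rewrite ler_piMl//; lra.
  rewrite kvn /G mulrCA ler_wpM2l// -expRD ler_expR natrB//.
  have d1 : d <= 1 by lra.
  have := sqrt_sub_ge _ _ _ n0 (ler0n _ (k.+1 * v)) kvd d1.
  rewrite -(ler_pM2l c_gt0) -/r; apply: le_trans; rewrite natrM.
  by rewrite le_eqVlt; apply/orP; left; apply/eqP; rewrite /x; field; rewrite gt_eqF.
under eq_bigr do rewrite -mulr_sumr.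
rewrite -mulr_sumr mulrC ler_pM2l ?expR_gt0//.
apply: (@le_trans _ _ (\sum_(k < K) (1 - d) ^+ 2 / x k ^+ 2)); last first.
  apply: ler_sum => k _.
  have kK : k.+1%:R <= K%:R :> R by rewrite ler_nat.
  have xd : x k <= d.
    rewrite ler_pdivrMr ?mulr_gt0//.
    apply: (@le_trans _ _ (2 * (c * K%:R))); last by lra.
    have -> : c * (1 + d) * k.+1%:R = (1 + d) * (c * k.+1%:R) by ring.
    by apply: ler_pM; [lra|rewrite mulr_ge0// ltW|lra|rewrite ler_pM2l].
  have y0 : 0 < 4 / d by rewrite divr_gt0.
  have := @sum_exp_ge R (x k) (4 / d) m (x0 k) _ y0 _.
  have -> : 4 / (4 / d) = d by field; rewrite gt_eqF.
  move=> hh; apply: (le_trans _ (hh _ _)).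
  - rewrite ler_pM2r ?invr_gt0 ?exprn_gt0// expr2 ler_pM2r; lra.
  - lra.
  apply: (@le_trans _ _ (L * r / 2 * (c / (2 * r)))).
    rewrite le_eqVlt; apply/orP; left; apply/eqP.
    have d00 : d != 0 by rewrite gt_eqF.
    apply: (mulIf d00); rewrite divfK//.
    have -> : L * r / 2 * (c / (2 * r)) * d = L * (c * d) / 4.
      by field; rewrite gt_eqF.
    by rewrite LE; field.
  apply: ler_pM; [lra| |lra|].
    by apply: divr_ge0; [exact: ltW|lra].
  rewrite /x ler_pM2r ?invr_gt0 ?mulr_gt0// -mulrA ler_peMr//; first exact: ltW.
  have k1 : 1 <= k.+1%:R :> R by rewrite ler1n.
  by rewrite -[leLHS]mulr1 ler_pM//; lra.
have -> : \sum_(k < K) (1 - d) ^+ 2 / x k ^+ 2 =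
    4 * h * (1 - d) ^+ 2 / ((1 + d) ^+ 2 * c ^+ 2) * n%:R.
  transitivity (4 * (1 - d) ^+ 2 / ((1 + d) ^+ 2 * c ^+ 2) * n%:R * h).
    rewrite mulr_sumr; apply: eq_bigr => k _; rewrite /x nE.
    have k0 : k.+1%:R != 0 :> R by rewrite pnatr_eq0.
    move: k0; move: (k.+1%:R) => a a0.
    by field; rewrite a0 !gt_eqF//; lra.
  by field; rewrite !gt_eqF//; lra.
apply: ler_peMl; first exact: ltW.
rewrite ler_pdivlMr; last by rewrite mulr_gt0 ?exprn_gt0 ?addr_gt0.
rewrite mul1r dE mulrCA ler_pM2l ?mulr_gt0//.
rewrite -subr_ge0.
have -> : (1 - d) ^+ 2 - (1 + d) ^+ 2 * (1 - 4 * d) = d ^+ 2 * (8 + 4 * d).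
  ring.
by rewrite mulr_ge0 ?sqr_ge0//; lra.
Qed.
(** The constant C makes the bound trivial up to the rank given by
    [npartitions_step], which carries the induction beyond it. *)
Lemma npartitions_ge (c : R) : 0 < c -> c < c0 R ->
  exists2 C : R, 0 < C & forall n, C * expR (c * sqrtn n) <= (npartitions n)%:R.
Proof.
move=> c_gt0 cc0; have [n1 step] := npartitions_step c c_gt0 cc0.
exists (expR (- (c * sqrtn n1))); first exact: expR_gt0.
elim/ltn_ind => n IH.
have [nn1|n1n] := leqP n n1.
  apply: (@le_trans _ _ 1); last by rewrite ler1n npartitions_gt0.
  rewrite -expRD expR_le1 addrC subr_le0 ler_pM2l// ler_wsqrtr// ler_nat//.
have n0 : (0 < n)%N by exact: leq_ltn_trans n1n.
have n0R : 0 < n%:R :> R by rewrite ltr0n.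
rewrite -(ler_pM2l n0R) mulrCA.
apply: (@le_trans _ _ (expR (- (c * sqrtn n1)) *
  \sum_(v < n.+1) \sum_(k < n | (k.+1 * v <= n)%N)
       v%:R * expR (c * sqrtn (n - k.+1 * v)))).
  by rewrite ler_pM2l ?expR_gt0// step// ltnW.
rewrite -natrM npartitions_rec natr_sum mulr_sumr; apply: ler_sum => v _.
rewrite natr_sum mulr_sumr; apply: ler_sum => k kvn.
have [->|v0] := posnP v; first by rewrite mul0r mulr0.
rewrite natrM mulrCA ler_pM2l ?ltr0n//; apply: IH.
by rewrite ltn_subrL n0 muln_gt0 v0.
Qed.

End PartitionBounds.

(** * Comparison of partition functions with different sets of parts *)

Lemma partition_sum_le (A : set nat) m n : A `<=` positive -> (m <= n)%N ->
  (partition_sum A m <= partition_sum A n)%N.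
Proof.
move=> A0 mn; apply: leq_card_fset_set_sub; first exact: finite_partitions_le.
by move=> s [? ? sm]; split => //; exact: leq_trans mn.
Qed.

Lemma partition_sum_positive n :
  (partition_sum positive n <= n.+1 * npartitions n)%N.
Proof.
rewrite -[X in npartitions X]addn0.
apply: partition_sum_le_function => // m _; exists (nseq m 1%N).
  by move=> a; rewrite mem_nseq => /andP[_ /eqP ->].
by rewrite sumn_nseq mul1n.
Qed.

(** The form in which all comparisons are made: the bound on f is only needed
    away from finitely many parts F, at the cost of a power of n + 1. *)
Lemma partition_sum_compare (A B : set nat) (F : seq nat) (f : nat -> nat)
    (R : realType) (c : R) n :
  A `<=` positive -> B `<=` positive -> {in F, forall b, (0 < b)%N} ->
  {homo f : b / (B `\` [set` F]) b >-> A b} ->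
  {in B `\` [set` F] &, injective f} ->
  (forall b, (B `\` [set` F]) b -> (f b)%:R <= c * b%:R) -> 0 <= c ->
  (partition_sum B n <= n.+1 ^ size F *
    partition_sum A (Num.truncn (c * n%:R)))%N.
Proof.
move=> A0 B0 F0 BA injf fc c_ge0.
apply: leq_trans (partition_sum_remove B F n B0 F0) _.
rewrite leq_mul2l; apply/orP; right.
apply: (partition_sum_map A _ f _ n) => // s sB sn.
rewrite truncn_ge_nat ?mulr_ge0//.
apply: (@le_trans _ _ (c * (sumn s)%:R)); last by rewrite ler_wpM2l// ler_nat.
elim: s sB {sn} => [|b s IH] sB; first by rewrite mulr0.
rewrite /= !natrD mulrDr lerD//; first by apply/fc/sB; rewrite mem_head.
by apply: IH => b' b's; apply: sB; rewrite inE b's orbT.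
Qed.

(** * The counting function *)

(** The counting function at integer arguments, independently of any real
    field. *)
Definition count_upto (A : set nat) (n : nat) : nat :=
  #|` fset_set (A `&` `I_n.+1)|.

Lemma count_upto0 (A : set nat) : A `<=` positive -> count_upto A 0 = 0%N.
Proof.
move=> A0; apply/eqP; rewrite cardfs_eq0; apply/eqP.
rewrite -[RHS]fset_set0; congr fset_set; apply/seteqP; split=> // a [/A0].
by rewrite /positive /= lt0n ltnS leqn0 => /negP.
Qed.

Lemma count_uptoS (A : set nat) (n : nat) :
  count_upto A n.+1 = (count_upto A n + `[< A n.+1 >])%N.
Proof.
have fin m : finite_set (A `&` `I_m) by apply: finite_setIr; exact: finite_II.
have E : A `&` `I_n.+2 = if `[< A n.+1 >] then (n.+1 |` (A `&` `I_n.+1))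
  else A `&` `I_n.+1.
  case: asboolP => An; apply/seteqP; split => a /=.
  - rewrite ltnS leq_eqVlt => -[Aa /predU1P[->|]]; first by left.
    by right.
  - by move=> [->//|[Aa an]]; split => //; exact: ltnW.
  - by rewrite ltnS leq_eqVlt => -[Aa /predU1P[aE|//]]; rewrite aE in Aa.
  - by move=> [Aa an]; split => //; exact: ltnW.
rewrite /count_upto E; case: asboolP => An; last by rewrite addn0.
rewrite fset_setU1// cardfsU1 addnC; congr (_ + _)%N.
suff : n.+1 \notin fset_set (A `&` `I_n.+1) by move=> ->.
by apply/negP; rewrite in_fset_set// inE => -[_] /=; rewrite ltnn.
Qed.

Lemma count_upto_le (A : set nat) : {homo count_upto A : m n / (m <= n)%N}.
Proof.
apply: homo_leq => [//|n p m|n]; first exact: leq_trans.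
by rewrite count_uptoS leq_addr.
Qed.

Lemma count_upto_leq (A : set nat) (n : nat) :
  A `<=` positive -> (count_upto A n <= n)%N.
Proof.
move=> A0; elim: n => [|n IH]; first by rewrite count_upto0.
by rewrite count_uptoS -addn1 leq_add// leq_b1.
Qed.

Lemma count_upto_lt (A : set nat) (a n : nat) :
  A n -> (a < n)%N -> (count_upto A a < count_upto A n)%N.
Proof.
case: n => // n An; rewrite ltnS => an.
rewrite count_uptoS; move/asboolP : An => ->; rewrite addn1 ltnS.
exact: count_upto_le.
Qed.

Lemma count_upto_inj (A : set nat) : {in A &, injective (count_upto A)}.
Proof.
move=> a b; rewrite !inE => Aa Ab E.
have [ab|ab|//] := ltngtP a b.
  by have := count_upto_lt _ _ _ Ab ab; rewrite E ltnn.
by have := count_upto_lt _ _ _ Aa ab; rewrite E ltnn.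
Qed.

(** The least n with at least k elements of A up to n is the k-th element of
    A. *)
Lemma count_upto_onto (A : set nat) (k N : nat) : A `<=` positive ->
  (0 < k)%N -> (k <= count_upto A N)%N -> exists2 a, A a & count_upto A a = k.
Proof.
move=> A0 k0 kN.
have ex : exists n, (k <= count_upto A n)%N by exists N.
case: (ex_minnP ex) => -[|a] ka amin.
  by move: ka; rewrite count_upto0// leqn0 => /eqP k00; rewrite k00 in k0.
have ak : (count_upto A a < k)%N.
  by rewrite ltnNge; apply/negP => /amin; rewrite ltnn.
move: ka ak; rewrite count_uptoS; case: asboolP => Aa; last first.
  by rewrite addn0 => h; rewrite ltnNge h.
rewrite addn1 => h1 h2; exists a.+1 => //.
rewrite count_uptoS; move/asboolP : Aa => ->; rewrite addn1.
by apply/eqP; rewrite eqn_leq h1 h2.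
Qed.

Lemma countingE (R : realType) (A : set nat) (n : nat) :
  Defs.counting A (n%:R : R) = count_upto A n.
Proof.
rewrite /Defs.counting /count_upto; congr (#|` fset_set _|); apply/seteqP.
by split=> a [Aa an]; split => //; move: an; rewrite /= ler_nat ltnS.
Qed.

(** * Logarithms *)

Section Logarithms.
Context {R : realType}.
Local Notation sqrtn n := (Num.sqrt (n%:R : R)).

(** Since n + 1 <= (1 + sqrt n)^2 = u^4 and log u < u. *)
Lemma ln_natS_le n : ln (n.+1%:R : R) <= 4 * Num.sqrt (1 + sqrtn n).
Proof.
have s0 : 0 <= sqrtn n by exact: sqrtr_ge0.
set u := Num.sqrt (1 + sqrtn n).
have uE : 1 + sqrtn n = u ^+ 2 by rewrite sqr_sqrtr// addr_ge0.
have u0 : 0 < u by rewrite sqrtr_gt0; lra.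
apply: (@le_trans _ _ (ln (u ^+ 4))); last first.
  rewrite lnXn// -mulr_natl; have := ln_sublinear u0; lra.
rewrite ler_ln ?posrE ?exprn_gt0// -[4%N]/(2 * 2)%N exprM -uE.
have nE : n%:R = sqrtn n ^+ 2 by rewrite sqr_sqrtr.
by rewrite -natr1 {1}nE; lra.
Qed.

(** This is log n = o(sqrt n), used to absorb the polynomial factors. *)
Lemma ln_negligible (K C e : R) : 0 <= K -> 0 <= C -> 0 < e ->
  exists N, forall n, (N <= n)%N -> K * ln n.+1%:R + C <= e * sqrtn n.
Proof.
move=> K0 C0 e0; pose t := (4 * K + C + e) / e.
have tE : t * e = 4 * K + C + e by rewrite divfK// gt_eqF.
have t1 : 1 <= t by rewrite ler_pdivlMr// mul1r; lra.
exists (Num.truncn (t ^+ 4)).+1 => n tn.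
have t4 : t ^+ 4 <= n%:R.
  by rewrite ltW// (lt_le_trans (truncnS_gt _))// ler_nat.
have s0 : 0 <= sqrtn n by exact: sqrtr_ge0.
have t2 : t ^+ 2 <= sqrtn n.
  rewrite -[leLHS]ger0_norm ?sqr_ge0// -sqrtr_sqr ler_wsqrtr//.
  by rewrite -exprM.
have := ln_natS_le n; set u := Num.sqrt (1 + _) => lnu.
have uE : 1 + sqrtn n = u ^+ 2 by rewrite sqr_sqrtr// addr_ge0.
have tu : t <= u.
  rewrite -[leLHS]ger0_norm; last by lra.
  by rewrite -sqrtr_sqr ler_wsqrtr//; lra.
have u1 : 1 <= u by lra.
have -> : sqrtn n = u ^+ 2 - 1 by lra.
apply: (@le_trans _ _ (K * (4 * u) + C)); first by rewrite lerD2r ler_wpM2l.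
have : e * t * u <= e * u * u by rewrite ler_wpM2r ?ler_wpM2l; lra.
rewrite [e * t]mulrC tE.
have : C + e <= (C + e) * u by rewrite ler_peMr//; lra.
by lra.
Qed.

Lemma sqrtrD_le (x y : R) : 0 <= x -> 0 <= y ->
  Num.sqrt (x + y) <= Num.sqrt x + Num.sqrt y.
Proof.
move=> x0 y0; have sx := sqrtr_ge0 x; have sy := sqrtr_ge0 y.
rewrite -[leRHS]ger0_norm ?addr_ge0// -sqrtr_sqr ler_wsqrtr//.
rewrite sqrrD !sqr_sqrtr// -addrA lerD2l lerDr.
by rewrite mulrn_wge0// mulr_ge0.
Qed.

Lemma ln_nat_ge0 n : 0 <= ln (n%:R : R).
Proof.
case: n => [|n]; first by rewrite ln0.
by rewrite ln_ge0// ler1n.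
Qed.

Lemma ln_nat_le n (x : R) : n%:R <= x -> 1 <= x -> ln (n%:R : R) <= ln x.
Proof.
case: n => [|n] nx x1; first by rewrite ln0// ln_ge0.
by rewrite ler_ln// posrE// (lt_le_trans ltr01).
Qed.

End Logarithms.

(** * Densities and limits *)

Section Limits.
Context {R : realType}.
Local Notation sqrtn n := (Num.sqrt (n%:R : R)).

Lemma limn_esup_le (u : nat -> R) (l : R) N :
  (forall n, (N <= n)%N -> u n <= l) ->
  (limn_esup (fun n => (u n)%:E) <= l%:E)%E.
Proof.
move=> ul; rewrite /limn_esup limf_esupE.
apply: (@le_trans _ _ (ereal_sup ((fun n => (u n)%:E) @` [set n | (N <= n)%N]))).
  by apply: ereal_inf_lbound; exists [set n | (N <= n)%N] => //; exists N.
by apply: ge_ereal_sup => _ [n Nn <-]; rewrite lee_fin ul.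
Qed.

Lemma limn_einf_ge (u : nat -> R) (l : R) N :
  (forall n, (N <= n)%N -> l <= u n) ->
  (l%:E <= limn_einf (fun n => (u n)%:E))%E.
Proof.
move=> lu; rewrite /limn_einf leeNr -EFinN.
by apply: (@limn_esup_le (fun n => - u n) (- l) N) => n /lu; rewrite lerN2.
Qed.

Lemma upper_density_eventually (A : set nat) (beta b : R) :
  (upper_density R A <= beta%:E)%E -> beta < b ->
  exists N, forall n, (N <= n)%N -> (count_upto A n)%:R <= b * n%:R.
Proof.
move=> Ab bb.
have : (upper_density R A < b%:E)%E by apply: le_lt_trans Ab _; rewrite lte_fin.
rewrite /upper_density limf_esupE => /ereal_inf_lt[_ [V [M [_ MV]] <-] Vb].
exists (Num.truncn (Num.max M 0)).+1 => n Mn.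
have : Num.max M 0 < n%:R :> R.
  by apply: lt_le_trans (truncnS_gt _) _; rewrite ler_nat.
rewrite gt_max => /andP[/MV Vn n0].
have := le_lt_trans (ereal_sup_ubound (ex_intro2 _ _ _ Vn erefl)) Vb.
by rewrite lte_fin countingE => /ltW; rewrite ler_pdivrMr.
Qed.

Lemma lower_density_eventually (A : set nat) (alpha a : R) :
  (alpha%:E <= lower_density R A)%E -> a < alpha ->
  exists N, forall n, (N <= n)%N -> a * n%:R <= (count_upto A n)%:R.
Proof.
move=> Aa aa.
have : (a%:E < lower_density R A)%E by apply: lt_le_trans Aa; rewrite lte_fin.
rewrite /lower_density limf_einfE => /ereal_sup_gt[_ [V [M [_ MV]] <-] Va].
exists (Num.truncn (Num.max M 0)).+1 => n Mn.
have : Num.max M 0 < n%:R :> R.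
  by apply: lt_le_trans (truncnS_gt _) _; rewrite ler_nat.
rewrite gt_max => /andP[/MV Vn n0].
have := lt_le_trans Va (ereal_inf_lbound (ex_intro2 _ _ _ Vn erefl)).
by rewrite lte_fin countingE => /ltW; rewrite ler_pdivlMr.
Qed.

(** The part a is replaced by the number of elements of A up to a, that is by
    its index in A: this maps a partition of n to one of size at most b n,
    once the parts below N have been discarded. *)
Lemma ln_partition_le (A : set nat) (b e : R) N :
  A `<=` positive -> 0 < b -> 0 < e ->
  (forall n, (N <= n)%N -> (count_upto A n)%:R <= b * n%:R) ->
  exists N', forall n, (N' <= n)%N ->
    ln (partition_function A n)%:R <= (c0 R * Num.sqrt b + e) * sqrtn n.
Proof.
move=> A0 b0 e0 Ab.
have [||N' HN'] := @ln_negligible R N.+1%:R (ln (b + 1)) e _ _ e0 => //.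
  by rewrite ln_ge0//; lra.
exists N' => n Nn.
pose m := Num.truncn (b * n%:R).
have mb : m%:R <= b * n%:R by rewrite truncn_le// mulr_ge0// ltW.
have key : (partition_function A n <= n.+1 ^ N * (m.+1 * npartitions m))%N.
  apply: (leq_trans (partition_function_le_sum A n A0)).
  apply: leq_trans (leq_mul (leqnn _) (partition_sum_positive m)).
  rewrite -[X in (_ ^ X)%N](size_iota 1).
  apply: (partition_sum_compare positive A (iota 1 N) (count_upto A)) => //.
  - by move=> a; rewrite mem_iota => /andP[].
  - move=> a [Aa _]; rewrite /positive /=.
    by rewrite -(count_upto0 A A0); apply: count_upto_lt => //; exact: A0.
  - by move=> x y; rewrite !inE => -[Ax _] [Ay _]; apply: count_upto_inj;
      rewrite inE.
  - move=> a [/[dup] Aa /A0 a0 aN]; apply: Ab; rewrite leqNgt; apply/negP => aN'.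
    by apply: aN; rewrite /= mem_iota a0 add1n ltnS ltnW.
  - exact: ltW.
have n1 : 1 <= n.+1%:R :> R by rewrite ler1n.
have E1 : 1 <= expR (c0 R * sqrtn m).
  by rewrite -expR0 ler_expR mulr_ge0// ltW// c0_gt0.
have keyR : (partition_function A n)%:R <=
    (b + 1) * n.+1%:R ^+ N.+1 * expR (c0 R * sqrtn m).
  apply: (@le_trans _ _ (n.+1 ^ N * (m.+1 * npartitions m))%:R).
    by rewrite ler_nat.
  rewrite natrM natrX natrM exprSr.
  have -> : (b + 1) * (n.+1%:R ^+ N * n.+1%:R) * expR (c0 R * sqrtn m) =
    n.+1%:R ^+ N * ((b + 1) * n.+1%:R * expR (c0 R * sqrtn m)) by ring.
  apply: ler_wpM2l; first by rewrite exprn_ge0.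
  apply: ler_pM => //; last exact: npartitions_le.
  by rewrite -[m.+1%:R]natr1 -[n.+1%:R]natr1 mulrDl mulrDr; have := ler0n R n; lra.
apply: le_trans (ln_nat_le _ _ keyR _) _.
  by rewrite !mulr_ege1 ?exprn_ege1//; lra.
rewrite lnM ?posrE ?mulr_gt0 ?exprn_gt0 ?expR_gt0//; last by lra.
rewrite lnM ?posrE ?exprn_gt0//; last by lra.
rewrite expRK lnXn// -[ln _ *+ _]mulr_natl.
have := HN' n Nn.
have : c0 R * sqrtn m <= c0 R * Num.sqrt b * sqrtn n.
  by rewrite -mulrA ler_pM2l ?c0_gt0// -sqrtrM ?ler_wsqrtr// ltW.
lra.
Qed.

(** The part k is replaced by the k-th element of A, which is at most k / a
    for k > N.  Starting from partitions of m ~ a (n - n0), this yields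
    partitions of size at most n - n0 with parts in A, which are then completed
    to partitions of n. *)
Lemma ln_partition_ge (A : set nat) (a c e : R) N :
  A `<=` positive -> is_gcd A 1 -> 0 < a -> 0 < c -> c < c0 R -> 0 < e ->
  (forall n, (N <= n)%N -> a * n%:R <= (count_upto A n)%:R) ->
  exists N', forall n, (N' <= n)%N ->
    (c * Num.sqrt a - e) * sqrtn n <= ln (partition_function A n)%:R.
Proof.
move=> A0 gcdA a0 c_gt0 cc0 e0 Aa.
have [n0 rep] := representable_large A A0 gcdA.
have [C C0 pC] := npartitions_ge c c_gt0 cc0.
have a1 : a <= 1.
  have := Aa N.+1 (leqnSn _).
  have : (count_upto A N.+1)%:R <= N.+1%:R :> R by rewrite ler_nat count_upto_leq.
  move=> h1 h2; rewrite -(ler_pM2r (_ : 0 < N.+1%:R)) ?mul1r//.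
  exact: le_trans h1.
have /choice[f fP] : forall k, exists x, (0 < k)%N -> A x /\ count_upto A x = k.
  move=> k; have [->|k0] := posnP k; first by exists 0%N.
  have [|x Ax xk] := count_upto_onto A k
      (N + (Num.truncn (k%:R / a)).+1) A0 k0; last by exists x.
  rewrite -(ler_nat R); apply: le_trans (Aa _ (leq_addr _ _)).
  rewrite mulrC -ler_pdivrMr// natrD.
  by rewrite (le_trans (ltW (truncnS_gt _)))// lerDr.
have fle k : (N < k)%N -> (f k)%:R <= a^-1 * k%:R.
  move=> Nk; have k0 : (0 < k)%N by exact: leq_ltn_trans Nk.
  have [Af fk] := fP k k0.
  have kf : (k <= f k)%N by rewrite -[leqLHS]fk count_upto_leq.
  have f0 : (0 < f k)%N by exact: leq_trans kf.
  have : (N <= (f k).-1)%N by rewrite -ltnS prednK// (leq_trans Nk).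
  move=> /Aa; have : (count_upto A (f k).-1 < k)%N.
    by rewrite -[ltnRHS]fk; apply: count_upto_lt => //; rewrite prednK.
  rewrite -(ler_nat R) -natr1 => h1 h2; rewrite ler_pdivlMl//.
  rewrite -(prednK f0) -natr1 mulrDr mulr1; lra.
have compare m : (partition_sum positive m <=
    m.+1 ^ N * partition_sum A (Num.truncn (a^-1 * m%:R)))%N.
  rewrite -[X in (_ ^ X)%N](size_iota 1).
  apply: (partition_sum_compare A positive (iota 1 N) f) => //.
  - by move=> b; rewrite mem_iota => /andP[].
  - by move=> k [k0 _]; case: (fP k k0).
  - move=> x y; rewrite !inE => -[x0 _] [y0 _] fxy.
    by have [_ <-] := fP x x0; have [_ <-] := fP y y0; rewrite fxy.
  - move=> k [k0 kN]; apply: fle; rewrite ltnNge; apply/negP => kN'.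
    by apply: kN; rewrite /= mem_iota k0 add1n ltnS.
  - by rewrite invr_ge0 ltW.
pose D : R := n0%:R + 1.
have D0 : 0 <= D by rewrite addr_ge0.
have [||N' HN'] := @ln_negligible R N.+1%:R
    (`|ln C| + c * Num.sqrt D) e _ _ e0 => //.
  by rewrite addr_ge0 ?mulr_ge0// ltW.
exists (N' + n0)%N => n Nn.
have n0n : (n0 <= n)%N by rewrite (leq_trans _ Nn)// leq_addl.
pose m := Num.truncn (a * (n - n0)%:R).
have an0 : 0 <= a * (n - n0)%:R by rewrite mulr_ge0// ltW.
have ma : m%:R <= a * (n - n0)%:R by rewrite truncn_le.
have mD : a * n%:R <= m%:R + D.
  have := truncnS_gt (a * (n - n0)%:R); rewrite -/m -natr1 natrB// => h.
  have : a * n0%:R <= n0%:R by rewrite ler_piMl.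
  by rewrite /D; lra.
have mn : (m <= n)%N.
  rewrite -(ler_nat R); apply: le_trans ma _.
  apply: (@le_trans _ _ (n - n0)%:R); first by rewrite ler_piMl.
  by rewrite ler_nat leq_subr.
have key : (npartitions m <= n.+1 ^ N.+1 * partition_function A n)%N.
  apply: leq_trans (partition_function_le_sum _ m positive_refl) _.
  apply: leq_trans (compare m) _.
  rewrite expnSr -mulnA leq_mul//; first by case: (N) => // k; rewrite leq_exp2r.
  apply: (@leq_trans (partition_sum A (n - n0))).
    apply: partition_sum_le => //.
    rewrite -(ler_nat R); apply: (@le_trans _ _ (a^-1 * m%:R)).
      by rewrite truncn_le mulr_ge0// invr_ge0 ltW.
    by rewrite ler_pdivrMl.
  apply: leq_trans (partition_sum_le_function A n0 (n - n0) A0 rep) _.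
  by rewrite subnK// leq_mul2r ltnS leq_subr orbT.
have pA0 : (0 < partition_function A n)%N.
  by have := leq_trans (npartitions_gt0 m) key; rewrite muln_gt0 => /andP[].
have keyR : C * expR (c * sqrtn m) <=
    n.+1%:R ^+ N.+1 * (partition_function A n)%:R.
  by apply: le_trans (pC m) _; rewrite -natrX -natrM ler_nat.
have : ln (C * expR (c * sqrtn m)) <=
    ln (n.+1%:R ^+ N.+1 * (partition_function A n)%:R).
  by rewrite ler_ln ?posrE ?mulr_gt0 ?expR_gt0 ?exprn_gt0 ?ltr0n.
rewrite !lnM ?posrE ?expR_gt0 ?exprn_gt0 ?ltr0n// expRK lnXn// -[ln _ *+ _]mulr_natl.
have := HN' n (leq_trans (leq_addr _ _) Nn).
have : Num.sqrt a * sqrtn n <= sqrtn m + Num.sqrt D.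
  rewrite -sqrtrM; last exact: ltW.
  apply: (@le_trans _ _ (Num.sqrt (m%:R + D))); first by rewrite ler_wsqrtr.
  exact: sqrtrD_le.
rewrite -(ler_pM2l c_gt0).
have := ler_norm (- ln C); rewrite normrN.
rewrite mulrBl -mulrA mulrDr; lra.
Qed.

End Limits.

(** Applies [ln_partition_ge] with sqrt a and c slightly below sqrt alpha and
    c0.  Each of the two factors loses at most eta / 4 after division by c0,
    and so does the additive error e. *)
Lemma limn_einf_log_partition_ratio_ge (R : realType) (A : set nat)
    (alpha eta : R) :
  A `<=` positive -> is_gcd A 1 -> 0 < eta < Num.sqrt alpha ->
  (alpha%:E <= lower_density R A)%E ->
  ((Num.sqrt alpha - eta)%:E <=
    limn_einf (fun n => (log_partition_ratio R A n)%:E))%E.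
Proof.
move=> A0 gcdA /andP[eta0 etas] dA.
set s := Num.sqrt alpha in etas *; have s0 : 0 < s by exact: lt_trans etas.
pose rho : R := 1 - eta / (4 * s).
have rhoE : rho * s = s - eta / 4 by rewrite /rho; field; rewrite gt_eqF.
have rho0 : 0 < rho by rewrite -(pmulr_lgt0 _ s0); lra.
have rho1 : rho < 1 by rewrite -(ltr_pM2r s0); lra.
have c00 := @c0_gt0 R.
have alphaE : alpha = s ^+ 2.
  by rewrite sqr_sqrtr// ltW// -sqrtr_gt0.
have [|N HN] := lower_density_eventually A alpha ((rho * s) ^+ 2) dA.
  by rewrite alphaE ltr_pXn2r// ?nnegrE; lra.
have [||||N' HN'] :=
  ln_partition_ge A ((rho * s) ^+ 2) (rho * c0 R) (c0 R * (eta / 4)) N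
    A0 gcdA _ _ _ _ HN.
- by rewrite exprn_gt0//; lra.
- by rewrite mulr_gt0.
- by rewrite gtr_pMl.
- by rewrite mulr_gt0//; lra.
apply: (@limn_einf_ge _ _ _ N'.+1) => n Nn.
have n0 : (0 < n)%N by exact: leq_ltn_trans Nn.
have r0 : 0 < Num.sqrt (n%:R : R) by rewrite sqrtr_gt0 ltr0n.
rewrite /log_partition_ratio ler_pdivlMr; last exact: mulr_gt0.
apply: le_trans (HN' n (ltnW Nn)); rewrite [leLHS]mulrA ler_pM2r//.
rewrite sqrtr_sqr ger0_norm; last by lra.
have -> : rho * c0 R * (rho * s) - c0 R * (eta / 4) =
    (rho * (rho * s) - eta / 4) * c0 R by ring.
rewrite ler_pM2r// rhoE mulrBr rhoE.
have : rho * (eta / 4) <= 1 * (eta / 4) by rewrite ler_pM2r; lra.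
by lra.
Qed.

Lemma limn_esup_log_partition_ratio_le (R : realType) (A : set nat)
    (beta eta : R) :
  A `<=` positive -> 0 <= beta -> 0 < eta ->
  (upper_density R A <= beta%:E)%E ->
  (limn_esup (fun n => (log_partition_ratio R A n)%:E) <=
    (Num.sqrt beta + eta)%:E)%E.
Proof.
move=> A0 beta0 eta0 dA; have c00 := @c0_gt0 R.
pose d := eta / 2; have d0 : 0 < d by rewrite divr_gt0.
have d2 : 0 < d ^+ 2 by rewrite exprn_gt0.
have [|N HN] := upper_density_eventually A beta (beta + d ^+ 2) dA.
  by rewrite ltrDl.
have [||N' HN'] := ln_partition_le A (beta + d ^+ 2) (c0 R * d) N A0 _ _ HN.
- by lra.
- by rewrite mulr_gt0.
apply: (@limn_esup_le _ _ _ N'.+1) => n Nn.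
have n0 : (0 < n)%N by exact: leq_ltn_trans Nn.
have r0 : 0 < Num.sqrt (n%:R : R) by rewrite sqrtr_gt0 ltr0n.
rewrite /log_partition_ratio ler_pdivrMr; last exact: mulr_gt0.
apply: (le_trans (HN' n (ltnW Nn))); rewrite [leRHS]mulrA ler_pM2r// -mulrDr mulrC.
rewrite ler_pM2r//; have := sqrtrD_le beta (d ^+ 2) beta0 (ltW d2).
by rewrite sqrtr_sqr ger0_norm /d; lra.
Qed.

Theorem theorem3 (R : realType) (A : set nat) (alpha beta : R)
    (A_pos : A `<=` [set a | (0 < a)%N])
    (A_infinite : infinite_set A)
    (A_gcd : is_gcd A 1)
    (alpha_ge0 : 0 <= alpha) (beta_ge0 : 0 <= beta) :
  ((alpha%:E <= lower_density R A)%E ->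
     ((Num.sqrt alpha)%:E <=
        limn_einf (fun n => (log_partition_ratio R A n)%:E))%E)
  /\
  ((upper_density R A <= beta%:E)%E ->
     (limn_esup (fun n => (log_partition_ratio R A n)%:E)
        <= (Num.sqrt beta)%:E)%E).
Proof.
split=> dA; last first.
  apply/lee_addgt0Pr => eta eta0; rewrite -EFinD.
  exact: limn_esup_log_partition_ratio_le.
apply/lee_subgt0Pr => eta eta0; rewrite -EFinB.
have [etas|etas] := ltP eta (Num.sqrt alpha).
  by apply: limn_einf_log_partition_ratio_ge; rewrite ?eta0.
apply: (@limn_einf_ge _ _ _ 0) => n _.
apply: (@le_trans _ _ 0); first by rewrite subr_le0.
rewrite /log_partition_ratio divr_ge0 ?ln_nat_ge0//.
by rewrite mulr_ge0 ?sqrtr_ge0// ltW// c0_gt0.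
Qed.
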